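(* There is a constant $C>0$ such that for every integer $n\ge 1$ and every classical constant $c\in\{0,1,\dots,2^n-1\}$ there exists a quantum circuit acting on an $n$-qubit register, one target qubit and $\log_2^* n$ clean ancilla qubits, consisting of Toffoli gates and Clifford gates, that implements the quantum-classical comparator $$|x\rangle|t\rangle\mapsto |x\rangle|t\oplus [x<c]\rangle,\qquad x\in\{0,1,\dots,2^n-1\},\ t\in\{0,1\},$$ (extended linearly), uses at most $3n$ Toffoli gates, and has depth at most $Cn$.
   Context: The $n$-qubit register stores the integer $x$ in binary; $[x<c]$ equals $1$ if $x<c$ and $0$ otherwise. $\log_2^* n$ is the iterated logarithm: the number of times $\log_2$ must be applied, starting from $n$, until the result is at most $1$. A Toffoli gate with controls $x,y$ and target $z$ (three distinct qubits) maps $|x,y,z\rangle\mapsto|x,y,z\oplus (x\wedge y)\rangle$. A clean ancilla qubit is a qubit that is guaranteed to be in state $|0\rangle$ at the start of the circuit and must be returned to $|0\rangle$ at the end, for every input on the other qubits. The depth of a circuit is the minimum number of layers into which its gates can be arranged so that gates in the same layer act on disjoint sets of qubits and the order of gates sharing a qubit is respected. *)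

(* Defs.v *)
From HB Require Import structures.
From mathcomp Require Import all_boot all_order all_algebra.
From mathcomp Require Import all_classical all_reals all_analysis.
From mathcomp.real_closed Require Import complex.

Set Implicit Arguments.
Unset Strict Implicit.
Unset Printing Implicit Defensive.

Import Order.TTheory GRing.Theory Num.Theory.
Local Open Scope ring_scope.
Local Open Scope complex_scope.

Definition log2 (R : realType) (x : R) : R := ln x / ln 2%:R.

Lemma log_star_subproof (R : realType) (x : R) :
  exists k, iter k (@log2 R) x <= 1.
Proof.
have ln2 : (0 : R) < ln 2%:R by apply: ln_gt0; rewrite ltr1n.
suff: forall (m : nat) (y : R), y <= m.+1%:R ->
    exists k, iter k (@log2 R) y <= 1.
  move/(_ (Num.bound `|x|) x); apply; apply: (le_trans (ler_norm x)).
  apply: ltW; apply: (lt_trans (archi_boundP (normr_ge0 x))).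
  by rewrite ltr_nat.
elim=> [|m IHm] y ym; first by exists 0%N.
case: (lerP y 1) => [y1|y1]; first by exists 0%N.
have [|k] := IHm (log2 y); last by rewrite -iterSr => ?; exists k.+1.
rewrite ler_pdivrMr // mulr_natl -lnXn ?ltr0n //.
rewrite ler_ln ?posrE ?exprn_gt0 ?ltr0n ?(lt_trans ltr01) //.
by apply: le_trans ym _; rewrite -natrX ler_nat ltn_expl.
Qed.

(* Iterates past the first one that is at most 1 may leave the domain of the
   logarithm, but [ex_minn] stops at that first one. *)
Definition log_star (R : realType) (x : R) : nat :=
  ex_minn (log_star_subproof x).

Definition bits (m : nat) := {ffun 'I_m -> bool}.

Definition state (R : realType) (m : nat) := {ffun bits m -> R[i]^o}.

Definition ket (R : realType) (m : nat) (b : bits m) : state R m :=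
  [ffun b' => (b' == b)%:R].

Definition set_qubit (m : nat) (b : bits m) (q : 'I_m) (v : bool) : bits m :=
  [ffun q' => if q' == q then v else b q'].

(* [Had], [Phase] and [CNOT] generate the Clifford group up to global phases;
   [NOT] equals [Had]; [Phase]; [Phase]; [Had]. *)
Inductive gate (m : nat) : Type :=
| NOT of 'I_m
| Had of 'I_m
| Phase of 'I_m
| CNOT of 'I_m & 'I_m
| Toffoli of 'I_m & 'I_m & 'I_m.

Definition gate_qubits (m : nat) (g : gate m) : {set 'I_m} :=
  match g with
  | NOT q | Had q | Phase q => [set q]
  | CNOT x z => [set x; z]
  | Toffoli x y z => [set x; y; z]
  end.

Definition gate_wf (m : nat) (g : gate m) : bool :=
  match g with
  | NOT _ | Had _ | Phase _ => true
  | CNOT x z => x != z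
  | Toffoli x y z => uniq [:: x; y; z]
  end.

Definition is_Toffoli (m : nat) (g : gate m) : bool :=
  if g is Toffoli _ _ _ then true else false.

Definition gate_ket (R : realType) (m : nat) (g : gate m) (b : bits m) :
    state R m :=
  match g with
  | NOT q => ket R (set_qubit b q (~~ b q))
  | Had q => ((Num.sqrt 2%:R)^-1)%:C *:
      (ket R (set_qubit b q false) + (-1) ^+ b q *: ket R (set_qubit b q true))
  | Phase q => 'i%C ^+ b q *: ket R b
  | CNOT x z => ket R (set_qubit b z (b z (+) b x))
  | Toffoli x y z => ket R (set_qubit b z (b z (+) (b x && b y)))
  end.

Definition gate_apply (R : realType) (m : nat) (g : gate m) (psi : state R m) :
    state R m :=
  \sum_(b : bits m) psi b *: gate_ket R g b.

Definition circuit (m : nat) := seq (gate m).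

(* The head of the list is the gate applied first. *)
Definition run (R : realType) (m : nat) (circ : circuit m) (psi : state R m) :
    state R m :=
  foldl (fun phi g => gate_apply g phi) psi circ.

(* [l] assigns a layer to each gate.  Strict increase along every pair of gates
   sharing a qubit says both that no layer contains such a pair and that their
   order is respected. *)
Definition is_layering (m : nat) (circ : circuit m) (d : nat)
    (l : {ffun 'I_(size circ) -> 'I_d}) : bool :=
  [forall i : 'I_(size circ), forall j : 'I_(size circ),
     (i < j)%N &&
     ~~ [disjoint gate_qubits (tnth (in_tuple circ) i)
               & gate_qubits (tnth (in_tuple circ) j)]
     ==> (l i < l j)%N].

Lemma depth_subproof (m : nat) (circ : circuit m) :
  exists d, [exists l : {ffun 'I_(size circ) -> 'I_d}, is_layering l].
Proof.
exists (size circ); apply/existsP; exists [ffun i => i].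
by apply/forallP=> i; apply/forallP=> j; rewrite !ffunE; apply/implyP=> /andP[].
Qed.

Definition depth (m : nat) (circ : circuit m) : nat :=
  ex_minn (depth_subproof circ).

(* |x>|t>|0...0>: qubits 0, ..., n-1 hold the bits of [x], least significant
   first, qubit n is the target and the last [k] qubits are the ancillas. *)
Definition input (n k x : nat) (t : bool) : bits (n + 1 + k) :=
  [ffun q : 'I_(n + 1 + k) =>
     if (q < n)%N then odd (x %/ 2 ^ q) else (q == n :> nat) && t].

(* [run] is linear, so the action on basis states determines the action on
   all superpositions with the ancillas in |0...0>. *)
Definition implements_comparator (R : realType) (n k c : nat)
    (circ : circuit (n + 1 + k)) : Prop :=
  forall (x : nat) (t : bool), (x < 2 ^ n)%N ->
    run circ (ket R (input n k x t)) = ket R (input n k x (t (+) (x < c)%N)).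

(* Main.v *)
(** With [y i] the bit telling whether [x] and [c] agree at position [i], the
    borrow of [x] modulo [2 ^ m.+1] is [c m (+) y m && (c m (+) borrow m)]. Two
    steps of this recursion have the form [r (+) z && borrow m] where
    [z = y m.+1 && y m] and [r] is linear in [y m.+1] and [z]. Since the inner
    borrow is multiplied by [z], it is only needed when the two register qubits
    [m] and [m.+1] hold 1, so these can serve as clean workspace for it
    (conditionally clean ancillas). Each pair of register qubits thus provides
    the room for the [z] and [r] of the next pair, and one Toffoli for [z] and
    one for the Horner step suffice per pair: together with the uncomputation
    about [2 * n] Toffoli gates and a single true ancilla for the topmost [z]. *)
Require Import Defs.
From mathcomp Require Import all_boot all_order all_algebra.
From mathcomp Require Import all_classical all_reals all_analysis.
From mathcomp.real_closed Require Import complex.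
From mathcomp Require Import zify.
Import Order.TTheory GRing.Theory Num.Theory.
Local Open Scope ring_scope.

Set Implicit Arguments.
Unset Strict Implicit.
Unset Printing Implicit Defensive.

(** * Classical reversible circuits on basis states *)

Section ClassicalCircuits.
Variable M : nat.
Implicit Types (g : gate M) (b : bits M) (circ : circuit M) (q z : 'I_M).

Definition classical g : bool :=
  match g with Had _ | Phase _ => false | _ => true end.

Definition gate_fun g b : bits M :=
  match g with
  | NOT q => set_qubit b q (~~ b q)
  | CNOT x z => set_qubit b z (b z (+) b x)
  | Toffoli x y z => set_qubit b z (b z (+) (b x && b y))
  | _ => b
  end.

Definition eval circ b : bits M := foldl (fun b g => gate_fun g b) b circ.

Lemma eval_cat circ1 circ2 b : eval (circ1 ++ circ2) b = eval circ2 (eval circ1 b).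
Proof. exact: foldl_cat. Qed.

Lemma eval_nseq (s : bool) g b : eval (nseq s g) b = if s then gate_fun g b else b.
Proof. by case: s. Qed.

Lemma set_qubitE b q v p : set_qubit b q v p = if p == q then v else b p.
Proof. by rewrite ffunE. Qed.

Lemma gate_apply_ket (R : realType) g b :
  gate_apply g (ket R b) = gate_ket R g b.
Proof.
have ketE b' : ket R b b' = (b' == b)%:R :> complex.complex R by rewrite ffunE.
rewrite /gate_apply (bigD1 b) //= ketE eqxx scale1r big1 ?addr0 // => b' /negbTE nb.
by rewrite ketE nb scale0r.
Qed.

(** Gates other than [Had] and [Phase] send basis states to basis states, which reduces the analysis
    to the Boolean map [eval]. *)
Lemma run_ket (R : realType) circ b :
  all classical circ -> run circ (ket R b) = ket R (eval circ b).
Proof.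
rewrite /run; elim: circ b => //= g circ IH b /andP[cg cc].
by rewrite gate_apply_ket -IH //; case: g cg.
Qed.

Lemma gate_funK g b : gate_wf g -> gate_fun g (gate_fun g b) = b.
Proof.
case: g => //= [q _|x z xz|x y z].
- by apply/ffunP=> p; rewrite !set_qubitE eqxx negbK; case: eqP => // ->.
- apply/ffunP=> p; rewrite !set_qubitE eqxx (negbTE xz) -addbA addbb addbF.
  by case: eqP => // ->.
- rewrite !inE negb_or => /andP[/andP[_ xz] /andP[yz _]].
  apply/ffunP=> p; rewrite !set_qubitE eqxx (negbTE xz) (negbTE yz) -addbA addbb addbF.
  by case: eqP => // ->.
Qed.

Lemma eval_revK circ b : all (@gate_wf M) circ -> eval (rev circ) (eval circ b) = b.
Proof.
elim: circ b => //= g circ IH b /andP[wg wc].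
by rewrite rev_cons -cats1 eval_cat IH //= gate_funK.
Qed.

Definition avoids q circ : bool := all (fun g => q \notin gate_qubits g) circ.

Lemma gate_fun_avoid q g b : q \notin gate_qubits g -> gate_fun g b q = b q.
Proof.
case: g => //= [p|x z|x y z]; rewrite set_qubitE !inE ?negb_or -?andbA.
- by move/negbTE->.
- by case/andP=> _ /negbTE->.
- by case/and3P=> _ _ /negbTE->.
Qed.

Lemma eval_avoid q circ b : avoids q circ -> eval circ b q = b q.
Proof.
elim: circ b => //= g circ IH b /andP[qg qc].
by rewrite IH // gate_fun_avoid.
Qed.

Lemma set_qubitC b q1 q2 v1 v2 : q1 != q2 ->
  set_qubit (set_qubit b q1 v1) q2 v2 = set_qubit (set_qubit b q2 v2) q1 v1.
Proof.
move=> n12; apply/ffunP=> p; rewrite !set_qubitE.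
by case: eqP => // ->; rewrite eq_sym (negbTE n12).
Qed.

Lemma gate_fun_set q g b v : q \notin gate_qubits g ->
  gate_fun g (set_qubit b q v) = set_qubit (gate_fun g b) q v.
Proof.
case: g => //= [p|x z|x y z]; rewrite !inE ?negb_or -?andbA.
- by move=> qp; rewrite set_qubitC // set_qubitE eq_sym (negbTE qp).
- case/andP=> qx qz; rewrite set_qubitC // !set_qubitE.
  by rewrite ![_ == q]eq_sym (negbTE qx) (negbTE qz).
- case/and3P=> qx qy qz; rewrite set_qubitC // !set_qubitE.
  by rewrite ![_ == q]eq_sym (negbTE qx) (negbTE qy) (negbTE qz).
Qed.

Lemma eval_set q circ b v : avoids q circ ->
  eval circ (set_qubit b q v) = set_qubit (eval circ b) q v.
Proof.
elim: circ b => //= g circ IH b /andP[qg qc].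
by rewrite gate_fun_set // IH.
Qed.

(** Compute, act, uncompute: [V] never touches [z], so the change of [z] commutes with [rev V],
    which undoes [V] because every gate involved is its own inverse. *)
Lemma eval_conj V mid z b f :
  all (@gate_wf M) V -> avoids z V ->
  eval mid (eval V b) = set_qubit (eval V b) z (eval V b z (+) f) ->
  eval (V ++ mid ++ rev V) b = set_qubit b z (b z (+) f).
Proof.
move=> wV zV midE; rewrite !eval_cat midE eval_set ?eval_revK ?eval_avoid //.
by rewrite /avoids all_rev.
Qed.

Lemma depth_le_size circ : (depth circ <= size circ)%N.
Proof.
rewrite /depth; case: ex_minnP => d _; apply.
apply/existsP; exists [ffun i => i].
by apply/forallP=> i; apply/forallP=> j; rewrite !ffunE; apply/implyP=> /andP[].
Qed.

End ClassicalCircuits.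

(** * Borrows and integer comparison *)

Fixpoint borrow (c y : nat -> bool) (m : nat) : bool :=
  if m is m'.+1 then c m' (+) (y m' && (c m' (+) borrow c y m')) else false.

Lemma eq_borrow c y y' m :
  (forall i, (i < m)%N -> y i = y' i) -> borrow c y m = borrow c y' m.
Proof.
elim: m => //= m IH yy'; rewrite yy' // IH // => i im.
by apply: yy'; apply: leqW.
Qed.

Lemma modn_exp2S x m :
  (x %% 2 ^ m.+1 = odd (x %/ 2 ^ m) * 2 ^ m + x %% 2 ^ m)%N.
Proof.
have p0 : (0 < 2 ^ m)%N by rewrite expn_gt0.
rewrite {1}(divn_eq x (2 ^ m)) -{1}(odd_double_half (x %/ 2 ^ m)).
rewrite mulnDl addnAC -muln2 -mulnA -expnS addnC modnMDl modn_small //.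
have := ltn_pmod x p0; rewrite expnS; case: odd; lia.
Qed.

(** If the top bits differ, they decide: [x] is smaller exactly when the bit of [c] is 1. If they
    agree, the borrow from below is passed on. *)
Lemma borrow_ltn x c m :
  borrow (fun i => odd (c %/ 2 ^ i)) (fun i => odd (x %/ 2 ^ i) == odd (c %/ 2 ^ i)) m
  = (x %% 2 ^ m < c %% 2 ^ m)%N.
Proof.
elim: m => [|m IH]; first by rewrite !modn1.
rewrite /= IH !modn_exp2S.
have p0 : (0 < 2 ^ m)%N by rewrite expn_gt0.
have := ltn_pmod x p0; have := ltn_pmod c p0.
by case: (odd (x %/ _)); case: (odd (c %/ _)) => /=; case: ltnP; lia.
Qed.

Lemma nat_pair_ind (P : nat -> Prop) :
  P 0%N -> P 1%N -> (forall m, P m -> P m.+2) -> forall m, P m.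
Proof.
move=> P0 P1 PS m; suff: P m /\ P m.+1 by case.
by elim: m => // m [Pm Pm1]; split=> //; apply: PS.
Qed.

Lemma ltn_add234 i m : (i < m)%N -> [/\ i < m.+2, i < m.+3 & i < m.+4]%N.
Proof. by move=> im; split; lia. Qed.

(** * The borrow circuit on conditionally clean qubits *)

Section Comparator.
Variables (M : nat) (e : nat -> 'I_M) (c : nat -> bool).

(* Adds to qubit [v] the part of [borrow c _ m.+2] that does not depend on
   [borrow c _ m], apart from the constant, which is replaced by [s]; qubit [u]
   holds the conjunction of qubits [m] and [m.+1]. *)
Definition load (s : bool) (m u v : nat) : circuit M :=
  nseq s (NOT (e v)) ++ nseq (c m.+1 (+) c m) (CNOT (e m.+1) (e v))
    ++ nseq (c m) (CNOT (e u) (e v)).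

(** Qubits [m'.+2] and [m'.+3] are expected to hold 1: the [NOT] clears the first for z, and
    negating [c m'.+1] absorbs the 1 in the second, which receives r. Qubits [m'] and [m'.+1] are
    read before the inner ladder reuses them; it leaves its borrow in [m'.+1]. Nothing is uncomputed
    here. *)
Fixpoint ladder (m : nat) : circuit M :=
  match m with
  | 0 => [:: NOT (e 1)]
  | 1 => nseq (~~ c 0) (NOT (e 2)) ++ nseq (c 0) (CNOT (e 0) (e 2))
  | m'.+2 =>
      [:: NOT (e m'.+2), Toffoli (e m') (e m'.+1) (e m'.+2)
        & load (~~ c m'.+1) m' m'.+2 m'.+3]
      ++ ladder m' ++ [:: Toffoli (e m'.+2) (e m'.+1) (e m'.+3)]
  end.

Lemma load_classical s m u v : all (@classical M) (load s m u v).
Proof. by rewrite !all_cat !all_nseq /= !orbT. Qed.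

Lemma load_Toffoli s m u v : count (@is_Toffoli M) (load s m u v) = 0%N.
Proof. by rewrite !count_cat !count_nseq /= !mul0n. Qed.

Lemma load_size s m u v : (size (load s m u v) <= s + 2)%N.
Proof. by rewrite !size_cat !size_nseq leq_add2l; case: (c m); case: (c m.+1). Qed.

Lemma ladder_classical m : all (@classical M) (ladder m).
Proof.
elim/nat_pair_ind: m => //= [|m IH].
  by rewrite all_cat !all_nseq !orbT.
by rewrite all_cat load_classical all_cat IH.
Qed.

Lemma ladder_Toffoli m : (count (@is_Toffoli M) (ladder m) <= m)%N.
Proof.
elim/nat_pair_ind: m => //= [|m IH].
  by rewrite count_cat !count_nseq !mul0n.
by rewrite count_cat load_Toffoli count_cat /=; lia.
Qed.

Lemma ladder_size m : (size (ladder m) <= 4 * m.+1)%N.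
Proof.
elim/nat_pair_ind: m => //= [|m IH].
  by rewrite size_cat !size_nseq; case: (c 0).
have := load_size (~~ c m.+1) m m.+2 m.+3.
by rewrite size_cat size_cat /=; case: (c m.+1) => /=; lia.
Qed.

Variable N : nat.
Hypothesis e_eq : forall i j, (i < N)%N -> (j < N)%N -> (e i == e j) = (i == j).

Lemma load_wf s m u v : (m.+1 < N)%N -> (u < N)%N -> (v < N)%N ->
  m.+1 != v -> u != v -> all (@gate_wf M) (load s m u v).
Proof.
move=> mN uN vN mv uv.
by rewrite !all_cat !all_nseq /= !e_eq // mv uv !orbT.
Qed.

Lemma load_avoids s m u v q : (m.+1 < N)%N -> (u < N)%N -> (v < N)%N ->
  (q < N)%N -> q != m.+1 -> q != u -> q != v -> avoids (e q) (load s m u v).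
Proof.
move=> mN uN vN qN qm qu qv.
rewrite /avoids !all_cat !all_nseq /= !inE !e_eq //.
by rewrite (negbTE qm) (negbTE qu) (negbTE qv) !orbT.
Qed.

Lemma eval_load s m u v b : (m.+1 < N)%N -> (u < N)%N -> (v < N)%N ->
  m.+1 != v -> u != v ->
  eval (load s m u v) b = set_qubit b (e v)
    (b (e v) (+) (s (+) (c m.+1 (+) c m) && b (e m.+1) (+) c m && b (e u))).
Proof.
move=> mN uN vN mv uv; rewrite !eval_cat !eval_nseq.
apply/ffunP => p; rewrite set_qubitE.
have [->|pv] := eqVneq p (e v); last first.
  by case: s; case: (c m); case: (c m.+1); rewrite /= ?set_qubitE ?(negbTE pv).
case: s; case: (c m); case: (c m.+1);
  rewrite /= ?set_qubitE ?eqxx ?(e_eq mN vN) ?(e_eq uN vN) ?(negbTE mv) ?(negbTE uv);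
  by case: (b (e v)); case: (b (e m.+1)); case: (b (e u)).
Qed.

Lemma ladder_wf m : (m.+1 < N)%N -> all (@gate_wf M) (ladder m).
Proof.
elim/nat_pair_ind: m => //= [N2|m IH mN].
  by rewrite all_cat !all_nseq /= e_eq ?orbT //; lia.
rewrite all_cat load_wf ?all_cat ?IH ?inE ?e_eq /= ?inE ?e_eq; lia.
Qed.

Lemma ladder_avoids m q : (m.+1 < q < N)%N -> avoids (e q) (ladder m).
Proof.
elim/nat_pair_ind: m => [|/=|m IH]; rewrite /avoids /= => /andP[mq qN].
- by rewrite inE e_eq; lia.
- by rewrite all_cat !all_nseq /= !inE !e_eq; lia.
- rewrite all_cat -/(avoids _ _) load_avoids ?all_cat -?/(avoids _ _) ?IH /= ?inE ?e_eq; lia.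
Qed.

(* Given that qubits [m] and [m.+1] hold 1, a [NOT] makes them clean. When they
   do not, the result is irrelevant: the caller multiplies it by their
   conjunction. *)
Lemma eval_ladder m (b : bits M) : (m.+1 < N)%N -> b (e m) -> b (e m.+1) ->
  eval (ladder m) b (e m.+1) = borrow c (b \o e) m.
Proof.
elim/nat_pair_ind: m b => [b _ _ b1|b N2 b1 b2|m IH b mN bu bv].
- by rewrite /= set_qubitE eqxx b1.
- rewrite /= eval_cat !eval_nseq.
  by case: (c 0); rewrite /= set_qubitE eqxx b2 ?andbT ?andbF.
rewrite [ladder _]/= -cat_cons -cat_cons 2!eval_cat.
set b1 := eval _ b.
have b1E i : (i < m.+4)%N -> b1 (e i) =
    if i == m.+2 then b (e m) && b (e m.+1) else
    if i == m.+3 then c m.+1 (+) (c m.+1 (+) c m) && b (e m.+1)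
                       (+) c m && (b (e m) && b (e m.+1)) else b (e i).
  move=> im; rewrite /b1 /= eval_load; try lia.
  rewrite !set_qubitE !e_eq; try lia.
  rewrite !eqxx bu bv.
  by do !case: eqP => //=; lia.
have [l3 mN1] : (m.+3 < m.+4)%N /\ (m.+1 < N)%N by split; lia.
have l2 := ltnW l3; have l1 := ltnW l2; have l0 := ltnW l1.
(* The inner ladder stays within qubits up to [m.+1], so z and r survive it. *)
have w2 : avoids (e m.+2) (ladder m) by apply: ladder_avoids; lia.
have w3 : avoids (e m.+3) (ladder m) by apply: ladder_avoids; lia.
clearbody b1.
rewrite /= set_qubitE eqxx (eval_avoid _ w2) (eval_avoid _ w3) !b1E // !eqxx.
rewrite [m.+3 == _]gtn_eqF //.
(* If z is 1, the inner ladder meets its precondition. If z is 0, its output is multiplied by 0 and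
   r alone is the borrow. *)
have [/andP[y0 y1]|] := boolP (b (e m) && b (e m.+1)).
  rewrite IH ?b1E ?ltn_eqF // (@eq_borrow _ _ (b \o e)) => [|i im /=].
    by rewrite /= y0 y1; case: (c m); case: (c m.+1); case: borrow.
  have [im2 im3 im4] := ltn_add234 im.
  by rewrite b1E ?ltn_eqF.
by rewrite /=; case: (b (e m)); case: (b (e m.+1)) => //= _;
  case: (c m); case: (c m.+1).
Qed.

(** The topmost level: the target [T] accumulates r and the ancilla [a] holds z. As [T] need not
    start at 1, [c m.+1] enters without negation. *)
Definition toggle_borrow (m : nat) : circuit M :=
  let T := m.+2 in let a := m.+3 in
  [:: Toffoli (e m) (e m.+1) (e a)]
  ++ (load (c m.+1) m a T
      ++ (ladder m ++ [:: Toffoli (e a) (e m.+1) (e T)] ++ rev (ladder m)))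
  ++ rev [:: Toffoli (e m) (e m.+1) (e a)].

Lemma eval_toggle_borrow m (b : bits M) : (m.+3 < N)%N -> ~~ b (e m.+3) ->
  eval (toggle_borrow m) b =
  set_qubit b (e m.+2) (b (e m.+2) (+) borrow c (b \o e) m.+2).
Proof.
move=> mN a0; apply: eval_conj.
- by rewrite /= !inE !e_eq; lia.
- by rewrite /avoids /= !inE !e_eq; lia.
have [l3 mN1] : (m.+3 < m.+4)%N /\ (m.+1 < N)%N by split; lia.
have l2 := ltnW l3; have l1 := ltnW l2; have l0 := ltnW l1.
rewrite eval_cat eval_load; try lia.
set b1 := eval _ b.
have b1E i : (i < m.+4)%N ->
    b1 (e i) = if i == m.+3 then b (e m) && b (e m.+1) else b (e i).
  by move=> im; rewrite /= set_qubitE e_eq ?(negbTE a0) //; lia.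
clearbody b1; set r := (X in _ (+) X); set b2 := set_qubit b1 _ _.
have b2E i : (i < m.+4)%N ->
    b2 (e i) = if i == m.+2 then b1 (e m.+2) (+) r else b1 (e i).
  by move=> im; rewrite set_qubitE e_eq //; lia.
(* Inside the conjugation that computes z, a second one by the ladder adds z times the inner borrow
   to the target. *)
rewrite (@eval_conj _ _ _ (e m.+2) _ (b1 (e m.+3) && borrow c (b \o e) m)).
- apply/ffunP => p; rewrite !set_qubitE eqxx; case: eqP => // _.
  rewrite -addbA; congr addb; rewrite /r !b1E // eqxx [m.+1 == _]ltn_eqF //=.
  by case: (b _); case: (b _); case: (c m); case: (c m.+1); case: borrow.
- by apply: ladder_wf; lia.
- by apply: ladder_avoids; lia.
have w2 : avoids (e m.+2) (ladder m) by apply: ladder_avoids; lia.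
have w3 : avoids (e m.+3) (ladder m) by apply: ladder_avoids; lia.
rewrite /=; congr set_qubit; congr addb; rewrite (eval_avoid _ w3) b2E //.
rewrite gtn_eqF // b1E // eqxx.
have [/andP[y0 y1]|//] := boolP (b (e m) && b (e m.+1)).
rewrite eval_ladder ?b2E ?b1E ?ltn_eqF //.
apply: eq_borrow => i im /=.
have [im2 im3 im4] := ltn_add234 im.
by rewrite b2E ?b1E ?ltn_eqF.
Qed.

(** * The full comparator and its gate counts *)

Fixpoint flip (n : nat) : circuit M :=
  if n is n'.+1 then nseq (~~ c n') (NOT (e n')) ++ flip n' else [::].

(** [flip n] turns the bits of x into agreement bits with [c], and its reverse restores them. One
    bit is compared without an ancilla, since [log_star] of 1 is 0. *)
Definition comparator (n : nat) : circuit M :=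
  flip n
  ++ (if n is m.+2 then toggle_borrow m
      else nseq (c 0) (NOT (e 1)) ++ nseq (c 0) (CNOT (e 0) (e 1)))
  ++ rev (flip n).

Lemma flip_size n : (size (flip n) <= n)%N.
Proof. by elim: n => //= n IH; rewrite size_cat size_nseq; case: (c n); lia. Qed.

Lemma flip_Toffoli n : count (@is_Toffoli M) (flip n) = 0%N.
Proof. by elim: n => //= n IH; rewrite count_cat count_nseq IH. Qed.

Lemma flip_classical n : all (@classical M) (flip n).
Proof. by elim: n => //= n IH; rewrite all_cat all_nseq orbT. Qed.

Lemma flip_wf n : all (@gate_wf M) (flip n).
Proof. by elim: n => //= n IH; rewrite all_cat all_nseq orbT. Qed.

Lemma flip_avoids n q : (n <= q < N)%N -> avoids (e q) (flip n).
Proof.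
elim: n => //= n IH nqN; rewrite /avoids all_cat all_nseq -/(avoids _ _) IH; last lia.
by rewrite /= inE e_eq; lia.
Qed.

Lemma eval_flip n i b : (i < n)%N -> (n <= N)%N ->
  eval (flip n) b (e i) = (b (e i) == c i).
Proof.
elim: n b => //= n IH b iSn nN; rewrite eval_cat eval_nseq.
have iN := leq_trans iSn nN.
have [ni|ni] := eqVneq n i.
  rewrite eval_avoid; last by apply: flip_avoids; rewrite ni leqnn.
  by rewrite ni; case: (c i); rewrite /= ?set_qubitE ?eqxx; case: (b _).
rewrite IH; [|lia..].
by case: (c n); rewrite //= set_qubitE e_eq // [i == n]eq_sym (negbTE ni).
Qed.

(** For [n >= 2], the flips have at most [2 * n] gates, the two ladders [8 * (n - 1)], the load and
    the three other Toffolis 6. *)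
Lemma comparator_size n : (0 < n)%N -> (size (comparator n) <= 10 * n)%N.
Proof.
case: n => // n _; rewrite size_cat size_cat size_rev.
move: (flip n.+1) (flip_size n.+1) => f; case: n => [|m] fs.
  by rewrite size_cat !size_nseq; case: (c 0) => /=; lia.
have := load_size (c m.+1) m m.+3 m.+2; have := ladder_size m.
rewrite /toggle_borrow; move: (load _ _ _ _) (ladder m) => l1 l2 ls2 ls1.
by rewrite /= !size_cat /= size_rev; case: (c _) ls1 => /=; lia.
Qed.

Lemma comparator_Toffoli n : (count (@is_Toffoli M) (comparator n) <= 3 * n)%N.
Proof.
rewrite count_cat count_cat count_rev flip_Toffoli.
case: n => [|[|m]]; try by rewrite count_cat !count_nseq !mul0n.
have := load_Toffoli (c m.+1) m m.+3 m.+2; have := ladder_Toffoli m.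
rewrite /toggle_borrow; move: (load _ _ _ _) (ladder m) => l1 l2 lT2 lT1.
by rewrite /= !count_cat /= count_rev lT1; lia.
Qed.

Lemma comparator_classical n : all (@classical M) (comparator n).
Proof.
rewrite all_cat all_cat all_rev flip_classical andbT /=.
case: n => [|[|m]]; try by rewrite all_cat !all_nseq !orbT.
by rewrite /toggle_borrow /= all_cat all_cat load_classical /= all_cat /= all_rev
  ladder_classical.
Qed.

(** The bound on [N] makes room for the target at position [n] and, from [n = 2] on, one ancilla at
    [n.+1]. *)
Lemma comparator_wf n : (n + (1 < n) < N)%N -> (0 < n)%N ->
  all (@gate_wf M) (comparator n).
Proof.
move=> nN n0; rewrite all_cat all_cat all_rev flip_wf andbT /=.
case: n n0 nN => // -[|m] _ mN.
  by rewrite all_cat !all_nseq /= e_eq ?orbT //; lia.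
have [mN1 mN3] : (m.+1 < N)%N /\ (m.+3 < N)%N by split; lia.
rewrite /toggle_borrow /= all_cat all_cat load_wf; try lia.
rewrite /= all_cat /= all_rev ladder_wf //= !inE !e_eq; lia.
Qed.

Lemma eval_comparator n (b : bits M) :
  (n + (1 < n) < N)%N -> (0 < n)%N -> (1 < n)%N ==> ~~ b (e n.+1) ->
  eval (comparator n) b =
  set_qubit b (e n) (b (e n) (+) borrow c (fun i => b (e i) == c i) n).
Proof.
move=> nN n0 a0; have nN' : (n < N)%N by lia.
apply: eval_conj; first exact: flip_wf.
  by apply: flip_avoids; rewrite leqnn.
rewrite -(@eq_borrow _ (eval (flip n) b \o e)); last first.
  by move=> i ni; rewrite /= eval_flip // ltnW.
have : (1 < n)%N ==> ~~ eval (flip n) b (e n.+1).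
  apply/implyP => n1; rewrite eval_avoid ?(implyP a0) //.
  by apply: flip_avoids; lia.
move: (eval _ b) => {a0}b; case: n n0 nN nN' => // -[|m] _ mN mN' a0.
  have e01 : (e 0 == e 1) = false by rewrite e_eq //; lia.
  rewrite eval_cat !eval_nseq; apply/ffunP=> p; rewrite set_qubitE /=.
  have [->|/negbTE p1] := eqVneq p (e 1); case: (c 0).
  - by rewrite /= !set_qubitE eqxx e01; case: (b (e 1)); case: (b (e 0)).
  - by rewrite /= andbF addbF.
  - by rewrite /= !set_qubitE p1.
  - by [].
by apply: eval_toggle_borrow => //; lia.
Qed.

End Comparator.

(** * Placing the comparator on the given register *)

Lemma log_star_gt0 (R : realType) n : (1 < n)%N -> (0 < log_star (n%:R : R))%N.
Proof.
move=> n1; rewrite /log_star; case: ex_minnP => -[|k] //=.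
by rewrite -[1]/(1%:R) ler_nat leqNgt n1.
Qed.

Theorem mainTheorem3 (R : realType) :
  exists C : R, 0 < C /\
    forall n : nat, (1 <= n)%N ->
    forall c : nat, (c < 2 ^ n)%N ->
    exists circ : circuit (n + 1 + log_star (n%:R : R)),
      [/\ all (@gate_wf _) circ,
          @implements_comparator R n (log_star (n%:R : R)) c circ,
          (count (@is_Toffoli _) circ <= 3 * n)%N
        & (depth circ)%:R <= C * n%:R].
Proof.
(* Depth is bounded by the number of gates, at most [10 * n]. *)
exists 10%:R; split=> [|n n0 c cn]; first by rewrite ltr0n.
set k := log_star _; have k1 : (1 < n)%N -> (0 < k)%N by exact: log_star_gt0.
have M0 : (0 < n + 1 + k)%N by lia.
(* Indices out of range default to qubit 0, so [e] is injective only below [n + 1 + k]. *)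
pose e i : 'I_(n + 1 + k) := insubd (Ordinal M0) i.
have eE i : (i < n + 1 + k)%N -> e i = i :> nat by move=> iM; rewrite val_insubd iM.
have e_eq i j : (i < n + 1 + k)%N -> (j < n + 1 + k)%N -> (e i == e j) = (i == j).
  by move=> iM jM; rewrite -val_eqE /= !eE.
have nM : (n + (1 < n) < n + 1 + k)%N by case: ltnP k1 => [_ /(_ isT)|_ _]; lia.
exists (comparator e (fun i => odd (c %/ 2 ^ i)) n); split.
- exact: (comparator_wf _ e_eq).
- move=> x t xn; rewrite run_ket ?comparator_classical //; congr ket.
  have inputE i : (i < n + 1 + k)%N -> input n k x t (e i) =
      if (i < n)%N then odd (x %/ 2 ^ i) else (i == n) && t.
    by move=> iM; rewrite ffunE eE.
  rewrite (eval_comparator _ e_eq) //; last first.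
    by apply/implyP=> n1; rewrite inputE ?ltnNge ?leqnSn ?gtn_eqF //; lia.
  rewrite (@eq_borrow _ _ (fun i => odd (x %/ 2 ^ i) == odd (c %/ 2 ^ i))); last first.
    by move=> i ni; rewrite inputE ?ni //; lia.
  rewrite borrow_ltn !modn_small // inputE ?ltnn ?eqxx; last by lia.
  apply/ffunP => q; rewrite set_qubitE [RHS]ffunE [input _ _ _ _ q]ffunE.
  rewrite -val_eqE /= eE; last by lia.
  by case: (ltngtP q n).
- exact: comparator_Toffoli.
- by rewrite -natrM ler_nat (leq_trans (depth_le_size _)) ?comparator_size.
Qed.
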